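(* Let $\Omega\subset\mathbb{R}^d$ be open and bounded, and let $k:\mathbb{R}^d\times\mathbb{R}^d\to[0,\infty]$ be a measurable kernel satisfying (SM), with symmetric part $k_s$. Assume that there is an even, nonnegative function $\rho\in L^1(\mathbb{R}^d)$ satisfying: (i) there exist $\delta_0>0$ and a double cone $\Lambda$ with apex at the origin such that $\Lambda\cap B_{\delta_0}(\mathbf{0})\subset\{\rho>0\}$; (ii) there exists $c_0>0$ such that for all $\mathbf{u}\in S_\Omega(\mathbb{R}^d;k)$ $$\iint_{\mathbb{R}^d\times\mathbb{R}^d}k_s(\mathbf{x},\mathbf{y})\left((\mathbf{u}(\mathbf{x})-\mathbf{u}(\mathbf{y}))\cdot\frac{\mathbf{x}-\mathbf{y}}{|\mathbf{x}-\mathbf{y}|}\right)^2d\mathbf{y}\,d\mathbf{x}\ \ge\ c_0\iint_{\mathbb{R}^d\times\mathbb{R}^d}\rho(\mathbf{x}-\mathbf{y})\left((\mathbf{u}(\mathbf{x})-\mathbf{u}(\mathbf{y}))\cdot\frac{\mathbf{x}-\mathbf{y}}{|\mathbf{x}-\mathbf{y}|}\right)^2d\mathbf{y}\,d\mathbf{x}.$$ Then there exists $C_P=C_P(\Omega,c_0,\rho,\delta_0,\Lambda)>0$ such that for all $\mathbf{u}\in S_\Omega(\mathbb{R}^d;k)$ $$\|\mathbf{u}\|^2_{L^2(\mathbb{R}^d)}\le C_P\iint_{\mathbb{R}^d\times\mathbb{R}^d}k_s(\mathbf{x},\mathbf{y})\left((\mathbf{u}(\mathbf{x})-\mathbf{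u}(\mathbf{y}))\cdot\frac{\mathbf{x}-\mathbf{y}}{|\mathbf{x}-\mathbf{y}|}\right)^2d\mathbf{y}\,d\mathbf{x}.$$
   Context: $k_s(\mathbf{x},\mathbf{y})=\frac12(k(\mathbf{x},\mathbf{y})+k(\mathbf{y},\mathbf{x}))$. Condition (SM): $\mathbf{x}\mapsto\int_{\mathbb{R}^d}\min\{1,|\mathbf{x}-\mathbf{y}|^2\}k_s(\mathbf{x},\mathbf{y})\,d\mathbf{y}$ belongs to $L^1_{loc}(\mathbb{R}^d)$. $S_\Omega(\mathbb{R}^d;k)$ is the set of $\mathbf{u}\in L^2(\mathbb{R}^d;\mathbb{R}^d)$ with $\mathbf{u}=\mathbf{0}$ a.e. on $\mathbb{R}^d\setminus\Omega$ and $\iint k_s(\mathbf{x},\mathbf{y})\big((\mathbf{u}(\mathbf{x})-\mathbf{u}(\mathbf{y}))\cdot\frac{\mathbf{x}-\mathbf{y}}{|\mathbf{x}-\mathbf{y}|}\big)^2d\mathbf{y}\,d\mathbf{x}<\infty$. Double cone with apex at the origin: $\Lambda=\{\mathbf{h}\in\mathbb{R}^d\setminus\{\mathbf{0}\}:\mathbf{h}/|\mathbf{h}|\in\mathcal{I}\cup(-\mathcal{I})\}$, where $\mathcal{I}$ is an open subset of $\mathbb{S}^{d-1}$ with $\mathcal{H}^{d-1}(\mathcal{I})>0$. *)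

(* Defs.v *)
From HB Require Import structures.
From mathcomp Require Import all_boot all_order all_algebra.
From mathcomp Require Import all_classical all_reals all_analysis.
From mathcomp Require Import measurable_realfun.

Set Implicit Arguments.
Unset Strict Implicit.
Unset Printing Implicit Defensive.

Import Order.TTheory GRing.Theory Num.Theory.
Import numFieldNormedType.Exports.

Local Open Scope classical_set_scope.
Local Open Scope ring_scope.

Definition measure_rV_display : measure_display.
Proof. by constructor. Qed.

Section measurable_rV.
Context {R : realType} (n : nat).

Definition rV_coord (i : 'I_n) (x : 'rV[R]_n) : measurableTypeR R := x 0 i.

(* The product sigma-algebra, as the library does for [n.-tuple T]; since [R]
   is second countable, these are the Borel sets of ['rV[R]_n]. *)
Let rV_set0 : g_sigma_preimage rV_coord set0.
Proof. exact: sigma_algebra0. Qed.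

Let rV_setC A : g_sigma_preimage rV_coord A -> g_sigma_preimage rV_coord (~` A).
Proof. exact: sigma_algebraC. Qed.

Let rV_bigcup (F : _^nat) : (forall i, g_sigma_preimage rV_coord (F i)) ->
  g_sigma_preimage rV_coord (\bigcup_i (F i)).
Proof. exact: sigma_algebra_bigcup. Qed.

HB.instance Definition _ := @isMeasurable.Build measure_rV_display
  'rV[R]_n (g_sigma_preimage rV_coord) rV_set0 rV_setC rV_bigcup.

End measurable_rV.

Lemma measurable_rV_coord (R : realType) n (i : 'I_n) :
  measurable_fun [set: 'rV[R]_n] (rV_coord i).
Proof.
move=> _ Y mY; rewrite setTI; apply: sub_sigma_algebra => /=.
rewrite -bigcup_seq/=; exists i => /=; first by rewrite mem_index_enum.
by exists Y => //; rewrite setTI.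
Qed.

Lemma measurable_fun_rVP (R : realType) d (T : measurableType d) n
    (f : T -> 'rV[R]_n) :
  (forall i, measurable_fun [set: T] (rV_coord i \o f)) ->
  measurable_fun [set: T] f.
Proof.
move=> mf _ A mA; rewrite setTI.
suff : g_sigma_preimage (@rV_coord R n) `<=` [set B | measurable (f @^-1` B)].
  exact.
apply: smallest_sub => /=.
- split => /=.
  + by rewrite preimage_set0.
  + by move=> B mB; rewrite setTD preimage_setC; exact: measurableC.
  + by move=> F mF; rewrite preimage_bigcup; exact: bigcupT_measurable.
- rewrite -bigcup_seq/=; apply: bigcup_sub => i _ _ [B mB <-] /=.
  by rewrite setTI -comp_preimage -[X in measurable X]setTI; exact: mf.
Qed.

Definition rV_cons {R : realType} n (p : measurableTypeR R * 'rV[R]_n) :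
  'rV[R]_n.+1 := row_mx (const_mx p.1 : 'rV[R]_1) p.2.

Lemma rV_cons0 (R : realType) n (p : measurableTypeR R * 'rV[R]_n) :
  rV_cons p 0 ord0 = p.1.
Proof.
rewrite /rV_cons (_ : ord0 = @lshift 1 n ord0); last exact: val_inj.
by rewrite (@row_mxEl _ 1 1 n) mxE.
Qed.

Lemma rV_consS (R : realType) n (p : measurableTypeR R * 'rV[R]_n) i :
  rV_cons p 0 (lift ord0 i) = p.2 0 i.
Proof.
rewrite /rV_cons (_ : lift ord0 i = @rshift 1 n i); last exact: val_inj.
by rewrite (@row_mxEr _ 1 1 n).
Qed.

Lemma measurable_rV_cons (R : realType) n :
  measurable_fun setT (@rV_cons R n).
Proof.
apply: measurable_fun_rVP => i; have [j ->|->] := unliftP ord0 i.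
- rewrite (_ : _ \o _ = rV_coord j \o snd).
    by apply: measurableT_comp => //; exact: measurable_rV_coord.
  by apply/funext => p; rewrite /= /rV_coord rV_consS.
- rewrite (_ : _ \o _ = fst)//.
  by apply/funext => p; rewrite /= /rV_coord rV_cons0.
Qed.

(* By slicing along the first coordinate: the image of the product measure
   [lebesgue_measure \x lebesgue_rV n] by [rV_cons]. *)
Fixpoint lebesgue_rV {R : realType} {n} : set 'rV[R]_n -> \bar R :=
  match n with
  | 0 => dirac (0 : 'rV[R]_0)
  | n'.+1 => fun A =>
     (\int[lebesgue_measure]_x lebesgue_rV [set v | A (rV_cons (x, v))])%E
  end.

Section lebesgue_rV_step.
Context {R : realType} (n : nat).
Variable m : {sigma_finite_measure set 'rV[R]_n -> \bar R}.
Local Open Scope ereal_scope.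

Definition lebesgue_rV_step : set 'rV[R]_n.+1 -> \bar R :=
  pushforward (@lebesgue_measure R \x m) (@rV_cons R n).

Let step0 : lebesgue_rV_step set0 = 0.
Proof. by rewrite /lebesgue_rV_step /pushforward preimage_set0 measure0. Qed.

Let step_ge0 A : 0 <= lebesgue_rV_step A.
Proof. by rewrite /lebesgue_rV_step /pushforward; exact: measure_ge0. Qed.

Let step_sigma_additive : semi_sigma_additive lebesgue_rV_step.
Proof.
move=> F mF tF mUF; rewrite /lebesgue_rV_step /pushforward preimage_bigcup.
apply: measure_semi_sigma_additive.
- by move=> i; rewrite -[X in measurable X]setTI; exact: measurable_rV_cons.
- apply/trivIsetP => /= i j _ _ ij; rewrite -preimage_setI.
  by move/trivIsetP : tF => /(_ _ _ _ _ ij) ->//; rewrite preimage_set0.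
- by rewrite -preimage_bigcup -[X in measurable X]setTI;
    exact: measurable_rV_cons.
Qed.

HB.instance Definition _ := isMeasure.Build _ _ _ lebesgue_rV_step
  step0 step_ge0 step_sigma_additive.

Definition rV_uncons (x : 'rV[R]_n.+1) : measurableTypeR R * 'rV[R]_n :=
  (x 0 ord0, \row_j x 0 (lift ord0 j))%R.

Lemma measurable_rV_uncons : measurable_fun setT rV_uncons.
Proof.
apply/measurable_fun_pairP; split; first exact: measurable_rV_coord.
apply: measurable_fun_rVP => i.
rewrite (_ : _ \o _ = rV_coord (lift ord0 i)); first exact: measurable_rV_coord.
by apply/funext => x; rewrite /= /rV_coord mxE.
Qed.

Lemma rV_consK : cancel (@rV_cons R n) rV_uncons.
Proof.
move=> [x v]; rewrite /rV_uncons rV_cons0; congr pair.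
by apply/rowP => j; rewrite mxE rV_consS.
Qed.

Let step_sigma_finite : sigma_finite setT lebesgue_rV_step.
Proof.
have /sigma_finiteP[F [TF ndF Foo]] := sigma_finiteT (@lebesgue_measure R).
have /sigma_finiteP[G [TG ndG Goo]] := sigma_finiteT m.
exists (fun i => rV_uncons @^-1` (F i `*` G i)).
  apply/seteqP; split => // x _.
  have [i _ Fi] : (\bigcup_i F i) (rV_uncons x).1 by rewrite -TF.
  have [j _ Gj] : (\bigcup_i G i) (rV_uncons x).2 by rewrite -TG.
  exists (maxn i j) => //; split.
    by move: Fi; exact/subsetPset/ndF/leq_maxl.
  by move: Gj; exact/subsetPset/ndG/leq_maxr.
move=> i; have [mF Fi] := Foo i; have [mG Gi] := Goo i; split.
  by rewrite -[X in measurable X]setTI; apply: measurable_rV_uncons => //;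
    exact: measurableX.
rewrite /lebesgue_rV_step /pushforward -comp_preimage.
rewrite (_ : _ \o _ = id); last by apply/funext => p /=; rewrite rV_consK.
by rewrite preimage_id product_measure1E// lte_mul_pinfty// ge0_fin_numE.
Qed.

HB.instance Definition _ := Measure_isSigmaFinite.Build _ _ _ lebesgue_rV_step
  step_sigma_finite.

End lebesgue_rV_step.

Lemma lebesgue_rV_sigma_finite_measure (R : realType) n :
  exists m : {sigma_finite_measure set 'rV[R]_n -> \bar R},
    m = @lebesgue_rV R n :> (set 'rV[R]_n -> \bar R).
Proof.
elim: n => [|n [m mE]]; first by exists (dirac (0 : 'rV[R]_0)).
exists (lebesgue_rV_step m); apply/funext => A /=.
rewrite /lebesgue_rV_step /pushforward /product_measure1 /=.
apply: eq_integral => x _ /=; rewrite mE; congr lebesgue_rV.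
by apply/seteqP; split => v /=; rewrite /xsection/= inE.
Qed.

Section lebesgue_rV_measure.
Context {R : realType} (n : nat).
Local Open Scope ereal_scope.

Let lebesgue_rV0 : @lebesgue_rV R n set0 = 0.
Proof. by have [m <-] := lebesgue_rV_sigma_finite_measure R n. Qed.

Let lebesgue_rV_ge0 A : 0 <= @lebesgue_rV R n A.
Proof. by have [m <-] := lebesgue_rV_sigma_finite_measure R n. Qed.

Let lebesgue_rV_sigma_additive : semi_sigma_additive (@lebesgue_rV R n).
Proof.
have [m <-] := lebesgue_rV_sigma_finite_measure R n.
exact: measure_semi_sigma_additive.
Qed.

HB.instance Definition _ := isMeasure.Build _ _ _ (@lebesgue_rV R n)
  lebesgue_rV0 lebesgue_rV_ge0 lebesgue_rV_sigma_additive.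

Let lebesgue_rV_sigma_finite : sigma_finite setT (@lebesgue_rV R n).
Proof.
have [m <-] := lebesgue_rV_sigma_finite_measure R n.
exact: sigma_finiteT.
Qed.

HB.instance Definition _ := Measure_isSigmaFinite.Build _ _ _
  (@lebesgue_rV R n) lebesgue_rV_sigma_finite.

End lebesgue_rV_measure.

Lemma lebesgue_rV_box (R : realType) n (A : 'I_n -> set (measurableTypeR R)) :
  (forall i, measurable (A i)) ->
  lebesgue_rV [set x : 'rV[R]_n | forall i, A i (x 0 i)] =
  (\prod_(i < n) lebesgue_measure (A i))%E.
Proof.
elim: n A => [|n IHn] A mA.
  by rewrite big_ord0 /= diracE mem_set// => -[].
rewrite big_ord_recl /=.
pose B := [set v : 'rV[R]_n | forall i, A (lift ord0 i) (v 0 i)].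
rewrite -(IHn (fun i => A (lift ord0 i)))//.
have mB : measurable B.
  rewrite (_ : B = \bigcap_i (rV_coord i @^-1` A (lift ord0 i))); last first.
    by apply/seteqP; split => v /= Bv i; [move=> _|]; exact: Bv.
  apply: fin_bigcap_measurable; first exact: finite_finset.
  by move=> i _; rewrite -[X in measurable X]setTI; exact: measurable_rV_coord.
transitivity (\int[lebesgue_measure]_x
    (cst (lebesgue_rV B) \_ (A ord0)) x)%E; last first.
  by rewrite -integral_mkcond integral_cst// muleC.
apply: eq_integral => x _; rewrite patchE.
have E v : (forall i, A i (rV_cons (x, v) 0 i)) <-> A ord0 x /\ B v.
  split=> [Av|[A0 Bv] i].
    split=> [|i]; first by have := Av ord0; rewrite rV_cons0.
    by have := Av (lift ord0 i); rewrite rV_consS.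
  by have [j ->|->] := unliftP ord0 i; rewrite (rV_consS, rV_cons0)//; exact: Bv.
case: ifPn => [/set_mem Ax|/negP Ax].
  by congr lebesgue_rV; apply/seteqP; split => v; [move=> /E[]|move=> ?; apply/E].
rewrite (_ : [set v | _] = set0) ?measure0//.
by apply/seteqP; split => v // /E[/mem_set].
Qed.

(* The sigma-algebras above are the Borel ones.  [f] is measurable for their
   completion, i.e., Lebesgue measurable if [mu] is [lebesgue_rV] or
   [lebesgue_rV \x lebesgue_rV].  For such an [f], [\int[mu] f] is still the
   Lebesgue integral: [f^\+] and [f^\-] are a.e. equal to Borel functions below
   them, so the Borel simple functions in the definition of the integral
   are enough to reach it. *)
Definition completed_measurable_fun d d' (T : measurableType d)
    (T' : measurableType d') (R : realType) (mu : set T -> \bar R)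
    (f : T -> T') :=
  forall B, measurable B -> completed_algebra_gen mu (f @^-1` B).

Definition L1 (R : realType) n (f : 'rV[R]_n -> \bar R) :=
  completed_measurable_fun lebesgue_rV f /\
  (\int[lebesgue_rV]_x `|f x| < +oo)%E.

Definition L1loc (R : realType) n (f : 'rV[R]_n -> \bar R) :=
  completed_measurable_fun lebesgue_rV f /\
  forall K, compact K -> (\int[lebesgue_rV]_(x in K) `|f x| < +oo)%E.

(* The library norm on ['rV[R]_n] is the sup norm; it has the same topology and
   the same bounded sets as the Euclidean norm [enorm]. *)
Section euclidean.
Context {R : realType} {n : nat}.
Implicit Types x y : 'rV[R]_n.

Definition dotv x y : R := \sum_i x 0 i * y 0 i.

Definition enorm x : R := Num.sqrt (dotv x x).

Definition eball (r : R) : set 'rV[R]_n := [set x | enorm x < r].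

Definition esphere : set 'rV[R]_n := [set x | enorm x = 1].

(* Equal to 0 at [x = 0]. *)
Definition direction x : 'rV[R]_n := (enorm x)^-1 *: x.

Definition L2norm (u : 'rV[R]_n -> 'rV[R]_n) : \bar R :=
  Lnorm lebesgue_rV 2%:E (fun x => (enorm (u x))%:E).

Definition diam (A : set 'rV[R]_n) : \bar R :=
  ereal_sup [set (enorm (x - y))%:E | x in A & y in A].

(* The empty set contributes 0 also when [s = 0]. *)
Definition diam_pow (s : nat) (A : set 'rV[R]_n) : \bar R :=
  if A == set0 then 0%E else (diam A ^+ s)%E.

Definition hausdorff_content (s : nat) (delta : R) (A : set 'rV[R]_n) :
    \bar R :=
  ereal_inf [set (\sum_(i <oo) diam_pow s (F i))%E | F in
    [set F : (set 'rV[R]_n)^nat |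
      A `<=` \bigcup_i F i /\ forall i, (diam (F i) <= delta%:E)%E]].

(* The supremum is the limit as [delta] tends to 0.  The usual normalization,
   a positive constant depending on [s] only, is omitted: it is irrelevant to
   the positivity of the measure. *)
Definition hausdorff_measure (s : nat) (A : set 'rV[R]_n) : \bar R :=
  ereal_sup [set hausdorff_content s delta A | delta in [set r | 0 < r]].

Definition double_cone (Lambda : set 'rV[R]_n) :=
  exists I : set 'rV[R]_n,
    [/\ exists2 U : set 'rV[R]_n, open U & I = esphere `&` U,
        (0 < hausdorff_measure n.-1 I)%E &
        Lambda = [set h | h != 0 /\ (I `|` [set - e | e in I]) (direction h)]].

End euclidean.

Section energy.
Context {R : realType} {n : nat}.
Local Notation V := 'rV[R]_n.
Implicit Types (k w : V * V -> \bar R) (u : V -> V).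
Local Open Scope ereal_scope.

Definition ksym k (z : V * V) : \bar R :=
  (2^-1)%:E * (k (z.1, z.2) + k (z.2, z.1)).

Definition cond_SM k :=
  L1loc (fun x : V =>
    \int[lebesgue_rV]_y
      ((Num.min 1 (enorm (x - y) ^+ 2))%R%:E * ksym k (x, y))).

Definition energy w u : \bar R :=
  \int[lebesgue_rV \x lebesgue_rV]_z
    (w z * (dotv (u z.1 - u z.2) (direction (z.1 - z.2)) ^+ 2)%R%:E).

Definition S_space (Omega : set V) k u :=
  [/\ completed_measurable_fun lebesgue_rV u,
      L2norm u < +oo,
      {ae lebesgue_rV, forall x, (~` Omega) x -> u x = 0%R} &
      energy (ksym k) u < +oo].

End energy.

(* Main.v *)
Require Import Defs.
From HB Require Import structures.
From mathcomp Require Import all_boot all_order all_algebra.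
From mathcomp Require Import all_classical all_reals all_analysis.
From mathcomp Require Import measurable_realfun ring lra.

Set Implicit Arguments.
Unset Strict Implicit.
Unset Printing Implicit Defensive.

Import Order.TTheory GRing.Theory Num.Theory.
Import numFieldNormedType.Exports.

Local Open Scope classical_set_scope.
Local Open Scope ring_scope.

Import HBNNSimple.

(** By (ii) it suffices to bound the [L^2] norm by the energy of [rho].  The
    double cone contains a small box away from the origin, and on a subset [B]
    of positive measure of that box [rho] is at least some [eps > 0].  For [h]
    in [B], a function vanishing outside the bounded set [Omega] vanishes after
    boundedly many steps [h], so telescoping and Cauchy-Schwarz give
    [\int (u x . h)^2 dx <= N^2 \int ((u (x + h) - u x) . h)^2 dx].
    Integrating over [h] in [B] bounds the right-hand side by the energy of
    [rho]; on the left [\int_B (v . h)^2 dh >= c |v|^2], because [B] cannot be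
    concentrated near a hyperplane. *)

(** * Comparison of integrals outside a null set *)

(* [f] and [g] need not be measurable: the integral of a nonnegative function
   is a supremum over the simple functions below it. *)
Lemma ge0_ae_le_integral_nonmeasurable d (T : measurableType d) (R : realType)
    (mu : {measure set T -> \bar R}) (N : set T) (f g : T -> \bar R) :
  measurable N -> mu N = 0%E ->
  (forall x, (0 <= f x)%E) -> (forall x, (0 <= g x)%E) ->
  (forall x, ~ N x -> (f x <= g x)%E) ->
  (\int[mu]_x f x <= \int[mu]_x g x)%E.
Proof.
move=> mN N0 f0 g0 fg; rewrite !ge0_integralTE//.
apply: ge_ereal_sup => /= _ [h hf <-].
have mNC : measurable (~` N) by exact: measurableC.
(* A simple function below [f] is cut to zero on [N], where [f] may exceed [g]; since [N] is null,
   its integral does not change. *)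
apply: ereal_sup_ubound => /=; exists (proj_nnsfun h mNC).
  move=> x /=; have [Nx|Nx] := pselect (N x).
    by rewrite /= mindicE memNset ?mulr0//; exact.
  rewrite /= mindicE mem_set// mulr1; exact: le_trans (fg _ Nx).
transitivity (sintegral mu (h \_ (~` N)))%E.
  by congr sintegral; apply/funext => x; rewrite mrestrict.
rewrite -integral_nnsfun// -setTD -ge0_negligible_integral//.
- by rewrite integral_nnsfun// patch_setT.
- exact/measurable_EFinP.
- by move=> x _; rewrite lee_fin.
Qed.

(** * Translation invariance on the line *)

(** Lebesgue measure is determined by its values on half-open intervals, and a translation preserves
    their lengths. *)
Lemma lebesgue_measure_shift (R : realType) (a : R)
    (A : set (measurableTypeR R)) :
  measurable A -> lebesgue_measure (+%R a @^-1` A) = lebesgue_measure A.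
Proof.
have ms : measurable_fun setT (+%R a : measurableTypeR R -> measurableTypeR R).
  by apply: measurable_funD.
pose f : {mfun measurableTypeR R >-> measurableTypeR R} :=
  HB.pack (+%R a : _ -> _) (isMeasurableFun.Build _ _ _ _ _ ms).
move=> mA; apply/esym.
apply: (@lebesgue_measure_unique _ (pushforward lebesgue_measure f)) => //.
move=> _ [[x y] _ <-] /=; rewrite /pushforward.
rewrite (_ : _ @^-1` _ = `](x - a)%R, (y - a)%R]%classic); last first.
  by apply/seteqP; split => z /=; rewrite !in_itv/= ltrBlDl lerBrDl.
rewrite !lebesgue_measure_itv/= !lte_fin.
by rewrite ltrD2r -!EFinB opprB addrA subrK.
Qed.

Lemma ge0_integral_shift (R : realType) (a : R)
    (f : measurableTypeR R -> \bar R) :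
  measurable_fun setT f -> (forall x, (0 <= f x)%E) ->
  (\int[lebesgue_measure]_x f (a + x)%R = \int[lebesgue_measure]_x f x)%E.
Proof.
have ms : measurable_fun setT (+%R a : measurableTypeR R -> measurableTypeR R).
  by apply: measurable_funD.
pose s : {mfun measurableTypeR R >-> measurableTypeR R} :=
  HB.pack (+%R a : _ -> _) (isMeasurableFun.Build _ _ _ _ _ ms).
move=> mf f0; transitivity (\int[pushforward lebesgue_measure s]_x f x)%E.
  by rewrite ge0_integral_pushforward.
apply: (@eq_measure_integral _ _ _ setT
  (lebesgue_measure : {measure set measurableTypeR R -> \bar R})) => A mA _.
exact: lebesgue_measure_shift.
Qed.

(** * Vector operations and translation invariance in dimension [n] *)

Section measurable_rV_ops.
Context d (T : measurableType d) (R : realType) (n : nat).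
Implicit Types f g : T -> 'rV[R]_n.

Lemma measurable_coord f (i : 'I_n) : measurable_fun setT f ->
  measurable_fun setT (fun x => f x 0 i).
Proof. by move=> mf; exact: measurableT_comp (measurable_rV_coord i) mf. Qed.

Lemma measurable_addv f g : measurable_fun setT f -> measurable_fun setT g ->
  measurable_fun setT (fun x => f x + g x).
Proof.
move=> mf mg; apply: measurable_fun_rVP => i.
rewrite (_ : _ \o _ = fun x => f x 0 i + g x 0 i).
  by apply: measurable_funD; exact: measurable_coord.
by apply/funext => x; rewrite /rV_coord /= mxE.
Qed.

Lemma measurable_subv f g : measurable_fun setT f -> measurable_fun setT g ->
  measurable_fun setT (fun x => f x - g x).
Proof.
move=> mf mg; apply: measurable_fun_rVP => i.
rewrite (_ : _ \o _ = fun x => f x 0 i - g x 0 i).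
  by apply: measurable_funB; exact: measurable_coord.
by apply/funext => x; rewrite /rV_coord /= !mxE.
Qed.

Lemma measurable_dotv f g : measurable_fun setT f -> measurable_fun setT g ->
  measurable_fun setT (fun x => dotv (f x) (g x)).
Proof.
move=> mf mg; apply: measurable_sum => i.
by apply: measurable_funM; exact: measurable_coord.
Qed.

End measurable_rV_ops.

(** Induction on the dimension by slicing: on each slice the tail of [a] is absorbed by the
    induction hypothesis, and the first coordinate of [a] by invariance of the outer one-dimensional
    integral. *)
Lemma lebesgue_rV_shift (R : realType) n (a : 'rV[R]_n) (A : set 'rV[R]_n) :
  measurable A -> lebesgue_rV (+%R a @^-1` A) = lebesgue_rV A.
Proof.
elim: n a A => [|n IHn] a A mA.
  congr lebesgue_rV; apply/seteqP; split => x /=; by rewrite !thinmx0.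
pose F (x : measurableTypeR R) :=
  lebesgue_rV [set v : 'rV[R]_n | A (rV_cons (x, v))].
have mA' : measurable (@rV_cons R n @^-1` A).
  by rewrite -[X in measurable X]setTI; exact: measurable_rV_cons.
have FE : F = lebesgue_rV \o xsection (@rV_cons R n @^-1` A).
  by apply/funext => x; rewrite /F /= xsectionE.
have mF : measurable_fun setT F by rewrite FE; exact: measurable_fun_xsection.
transitivity (\int[lebesgue_measure]_x F (a 0 ord0 + x)%R)%E; last first.
  by rewrite ge0_integral_shift// => x; exact: measure_ge0.
apply: eq_integral => x _; rewrite /F.
rewrite -(IHn (\row_j a 0 (lift ord0 j))
  [set v | A (rV_cons (a 0 ord0 + x, v))]).
  congr lebesgue_rV; apply/seteqP.
  have E v : a + rV_cons (x, v) =
      rV_cons (a 0 ord0 + x, (\row_j a 0 (lift ord0 j)) + v).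
    apply/rowP => i; rewrite mxE; have [j ->|->] := unliftP ord0 i.
      by rewrite !rV_consS/= !mxE.
    by rewrite !rV_cons0.
  by split => v /=; rewrite E.
rewrite (_ : mkset _ = xsection (@rV_cons R n @^-1` A) (a 0 ord0 + x)).
  exact: measurable_xsection.
by rewrite xsectionE.
Qed.

Lemma ge0_integral_rV_shift (R : realType) n (a : 'rV[R]_n)
    (f : 'rV[R]_n -> \bar R) :
  measurable_fun setT f -> (forall x, (0 <= f x)%E) ->
  (\int[lebesgue_rV]_x f (a + x)%R = \int[lebesgue_rV]_x f x)%E.
Proof.
have ms : measurable_fun setT (+%R a : 'rV[R]_n -> _).
  by apply: measurable_addv.
pose s : {mfun 'rV[R]_n >-> 'rV[R]_n} :=
  HB.pack (+%R a : _ -> _) (isMeasurableFun.Build _ _ _ _ _ ms).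
move=> mf f0; transitivity (\int[pushforward lebesgue_rV s]_x f x)%E.
  by rewrite ge0_integral_pushforward.
apply: (@eq_measure_integral _ _ _ setT
  (lebesgue_rV : {measure set 'rV[R]_n -> \bar R})) => A mA _.
exact: lebesgue_rV_shift.
Qed.

(** * Borel representatives and superlevel sets of Lebesgue measurable functions *)

(** The countably many sets where a coordinate of [u] exceeds a rational determine [u]. Each is
    Borel up to a null set, and [N] collects these null sets together with a null Borel set around
    [M]. The set [M] leaves room for the points where an almost everywhere property of [u] fails. *)
Lemma completed_measurable_funE d (T : measurableType d) (R : realType)
    (mu : {measure set T -> \bar R}) n (u : T -> 'rV[R]_n) (M : set T) :
  completed_measurable_fun mu u -> mu.-negligible M ->
  exists N, [/\ measurable N, mu N = 0%E, M `<=` N &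
    measurable_fun setT (u \_ (~` N))].
Proof.
move=> mu_u [M' [mM' M'0 MM']].
pose S (p : 'I_n * rat) := [set x | ratr p.2 < u x 0 p.1].
have : forall p, exists AN : set T * set T,
    [/\ measurable AN.1, measurable AN.2, mu AN.2 = 0%E, AN.1 `<=` S p &
        S p `<=` AN.1 `|` AN.2].
  move=> [i q].
  have /mu_u[A mA [N [N' [mN' N'0 NN']]] AN] :
      measurable (rV_coord i @^-1` `]ratr q, +oo[%classic : set 'rV[R]_n).
    by rewrite -[X in measurable X]setTI; exact: measurable_rV_coord.
  have SE : S (i, q) = A `|` N.
    by rewrite AN; apply/seteqP; split => x /=; rewrite in_itv/= andbT.
  exists (A, N'); split => //=; rewrite SE => x /=; first by left.
  by case; [left|right; exact: NN'].
move=> /choice[f fP].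
pose G k := if unpickle k is Some p then (f p).2 else set0.
have mG k : measurable (G k).
  by rewrite /G; case: unpickle => // p; have [] := fP p.
have G0 k : mu (G k) = 0%E.
  by rewrite /G; case: unpickle => [p|]; [have [] := fP p | rewrite measure0].
pose N := M' `|` \bigcup_k G k.
have mN : measurable N by apply: measurableU => //; exact: bigcupT_measurable.
exists N; split => //.
- have : mu.-negligible N.
    apply: negligibleU; first by exists M'; split.
    by apply: negligible_bigcup => k; exists (G k); split.
  by move/(negligibleP mu mN).
- by move=> x /MM' ?; left.
have fN p : (f p).2 `<=` N.
  by move=> x fx; right; exists (pickle p) => //; rewrite /G pickleK.
have SA p x : ~ N x -> S p x <-> (f p).1 x.
  have [_ _ _ AS SAN] := fP p; move=> Nx; split; last exact: AS.
  by move=> /SAN[//|/fN].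
apply: measurable_fun_rVP => i.
move=> mT; apply: (measurability _ (RGenOInfty.measurableE R)) => //.
move=> _ [_ [a ->] <-]; rewrite setTI.
pose F q := if a <= ratr q then (f (i, q)).1 `\` N else set0.
(* The restricted function is 0 on [N], so [N] belongs to the superlevel set exactly when [a < 0].
   Off [N], a value exceeds [a] iff it exceeds some rational [q] with [a <= q]. *)
rewrite (_ : _ @^-1` _ = (if a < 0 then N else set0) `|` \bigcup_q F q).
  apply: measurableU; first by case: ifP.
  apply: bigcupT_measurable_rat => q; rewrite /F; case: ifP => // _.
  by apply: measurableD => //; have [] := fP (i, q).
apply/seteqP; split => x /=; rewrite in_itv/= andbT /rV_coord patchE.
  case: ifPn => [/set_mem Nx ax|/negP Nx].
    have [q] := rat_in_itvoo ax; rewrite in_itv/= => /andP[aq qu]; right.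
    exists q => //; rewrite /F (ltW aq); split => //.
    exact/(SA (i, q) x Nx).
  rewrite mxE => ->; left; apply: contrapT => Nx'; apply: Nx.
  exact/mem_set.
move=> [|[q _]].
  case: ifPn => // a0 Nx; rewrite memNset ?mxE//=; exact.
rewrite /F; case: ifPn => // aq [Ax Nx]; rewrite mem_set//.
by move/(SA (i, q) x Nx) : Ax; exact: le_lt_trans.
Qed.

(** The sets where [f] exceeds [1 / (k + 1)] exhaust [Q]. If the Borel part of each met [Q] in a
    null set, [Q] would be a countable union of negligible sets. *)
Lemma completed_superlevel_measure_gt0 d (T : measurableType d) (R : realType)
    (mu : {measure set T -> \bar R}) (f : T -> R) (Q : set T) :
  completed_measurable_fun mu (EFin \o f) -> measurable Q -> (0 < mu Q)%E ->
  (forall x, Q x -> 0 < f x) ->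
  exists eps B, [/\ 0 < eps, measurable B, B `<=` Q, (0 < mu B)%E &
    forall x, B x -> eps < f x].
Proof.
move=> mf mQ Q0 f0.
have : forall k, exists AN : set T * set T,
    [/\ measurable AN.1, mu.-negligible AN.2 &
        [set x | k.+1%:R^-1 < f x] = AN.1 `|` AN.2].
  move=> k.
  have /mf[A mA [N N0 AN]] :
      measurable (`]k.+1%:R^-1%:E, +oo[%classic : set (\bar R)).
    exact: emeasurable_itv.
  exists (A, N); split => //=; rewrite AN.
  by apply/seteqP; split => x /=; rewrite in_itv/= andbT lte_fin.
move=> /choice[g gP].
have [k Qk] : exists k, mu (Q `&` (g k).1) != 0%E.
  apply: contrapT => /forallNP Qg; move: Q0; apply/negP; rewrite -leNgt.
  have neg : mu.-negligible (\bigcup_k ((Q `&` (g k).1) `|` (g k).2)).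
    apply: negligible_bigcup => k; have [mg Ng _] := gP k.
    apply: negligibleU => //; exists (Q `&` (g k).1); split => //.
      exact: measurableI.
    by have /negP := Qg k; rewrite negbK => /eqP.
  have : mu.-negligible Q.
    apply: negligibleS neg => x Qx.
    have [k kf] : exists k, k.+1%:R^-1 < f x.
      have := ltr_add_invr (f0 _ Qx); case => k; rewrite add0r => ?.
      by exists k.
    exists k => //; have [_ _ E] := gP k.
    have : ((g k).1 `|` (g k).2) x by rewrite -E.
    by case => ?; [left|right].
  by move/(negligibleP mu mQ) => ->.
have [mg _ E] := gP k.
exists k.+1%:R^-1, (Q `&` (g k).1); split => //.
- exact: measurableI.
- by rewrite lt0e Qk measure_ge0.
- by move=> x [_ gx]; have : [set x | k.+1%:R^-1 < f x] x by rewrite E; left.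
Qed.

(** * Euclidean norm and direction *)

Section euclidean_norm.
Context {R : realType} {n : nat}.
Implicit Types x y : 'rV[R]_n.

Lemma dotv_ge0 x : 0 <= dotv x x.
Proof. by apply: sumr_ge0 => i _; rewrite -expr2 sqr_ge0. Qed.

Lemma sqr_enorm x : enorm x ^+ 2 = dotv x x.
Proof. by rewrite sqr_sqrtr// dotv_ge0. Qed.

Lemma dotvZr a x y : dotv x (a *: y) = a * dotv x y.
Proof.
by rewrite /dotv mulr_sumr; apply: eq_bigr => i _; rewrite mxE mulrCA.
Qed.

Lemma dotvDr x y z : dotv x (y + z) = dotv x y + dotv x z.
Proof. by rewrite -big_split; apply: eq_bigr => i _; rewrite mxE mulrDr. Qed.

Lemma dotvBl x y z : dotv (x - y) z = dotv x z - dotv y z.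
Proof.
by rewrite -sumrB; apply: eq_bigr => i _; rewrite !mxE mulrBl.
Qed.

Lemma enormZ a x : enorm (a *: x) = `|a| * enorm x.
Proof.
rewrite /enorm -sqrtr_sqr -sqrtrM ?sqr_ge0//; congr Num.sqrt.
by rewrite mulr_sumr; apply: eq_bigr => i _; rewrite !mxE expr2; ring.
Qed.

Lemma enorm_eq0 x : (enorm x == 0) = (x == 0).
Proof.
apply/eqP/eqP => [x0|->]; last first.
  by rewrite -[0](scale0r (0 : 'rV[R]_n)) enormZ normr0 mul0r.
have : dotv x x = 0 by rewrite -sqr_enorm x0 expr0n.
move=> /eqP; rewrite psumr_eq0; last by move=> i _; rewrite -expr2 sqr_ge0.
move=> /allP xx; apply/rowP => i; rewrite mxE; apply/eqP.
by have := xx i (mem_index_enum _); rewrite mulf_eq0 orbb.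
Qed.

Lemma enorm_gt0 x : (0 < enorm x) = (x != 0).
Proof. by rewrite lt_def enorm_eq0 sqrtr_ge0 andbT. Qed.

Lemma enorm_direction x : x != 0 -> enorm (direction x) = 1.
Proof.
move=> x0; rewrite enormZ ger0_norm ?invr_ge0 ?sqrtr_ge0// mulVf//.
by rewrite enorm_eq0.
Qed.

Lemma direction_scale a x : 0 < a -> enorm x = 1 -> direction (a *: x) = x.
Proof.
move=> a0 x1; rewrite /direction enormZ x1 mulr1 gtr0_norm// scalerA.
rewrite mulVf ?scale1r//.
exact: lt0r_neq0.
Qed.

Lemma enorm_continuous : continuous (@enorm R n).
Proof.
move=> x; apply: continuous_comp; last exact: sqrt_continuous.
have : continuous (fun y : 'rV[R]_n => \sum_i y 0 i * y 0 i).
  apply: continuous_big => [|i _ y]; first exact: add_continuous.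
  exact: (cvgM (@coord_continuous R 1 n 0 i y) (@coord_continuous R 1 n 0 i y)).
exact.
Qed.

Lemma direction_continuous x : x != 0 -> {for x, continuous (@direction R n)}.
Proof.
move=> x0; have ex0 : enorm x != 0 by rewrite enorm_eq0.
exact: (cvgZ (cvgV ex0 (@enorm_continuous x)) (@cvg_id _ (nbhs x))).
Qed.

End euclidean_norm.

(** * A box inside the double cone *)

(** This turns the positive measure of the aperture of a cone into a point of it. The covering by
    empty sets has sum 0 for every exponent, by the convention in [diam_pow]. *)
Lemma hausdorff_measure_set0 (R : realType) n s :
  hausdorff_measure s (set0 : set 'rV[R]_n) = 0%E.
Proof.
have c0 (delta : R) : 0 < delta ->
    (hausdorff_content s delta (set0 : set 'rV[R]_n) <= 0)%E.
  move=> d0; apply: ereal_inf_lbound; exists (fun=> set0) => /=.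
    split=> // _; apply: ge_ereal_sup => _ [x []].
  by apply: eseries0 => i _ _; rewrite /diam_pow eqxx.
apply/eqP; rewrite eq_le; apply/andP; split.
  by apply: ge_ereal_sup => _ [delta d0 <-]; exact: c0.
apply: le_trans (ereal_sup_ubound _); last by exists 1 => //=; exact: ltr01.
apply: le_ereal_inf_tmp => _ [F _ <-]; apply: nneseries_ge0 => i _ _.
rewrite /diam_pow; case: ifPn => // /set0P[x Fx]; apply: expe_ge0.
apply: ereal_sup_ubound; exists x => //; exists x => //.
by rewrite subrr (_ : enorm 0 = 0)//; apply/eqP; rewrite enorm_eq0.
Qed.

(** A point [e] of the aperture, scaled into the ball, has a neighbourhood on which all three
    conditions persist, by continuity. The lower bound [s] on one coordinate later limits the number
    of steps [h] that fit into a bounded set. *)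
Lemma double_cone_box (R : realType) n (Lambda : set 'rV[R]_n) (delta : R) :
  double_cone Lambda -> 0 < delta ->
  exists (a : 'rV[R]_n) (r s : R) (i : 'I_n), [/\ 0 < r, 0 < s &
    forall h : 'rV[R]_n, (forall j, `|h 0 j - a 0 j| < r) ->
      [/\ Lambda h, eball delta h & s < `|h 0 i|]].
Proof.
move=> [I [[U oU IE] I0 ->]] delta0.
have [e Ie] : I !=set0.
  by apply/set0P/eqP => I_0; move: I0; rewrite I_0 hausdorff_measure_set0 ltxx.
have [e1 Ue] : enorm e = 1 /\ U e by move: Ie; rewrite IE.
have e0 : e != 0 by rewrite -enorm_eq0 e1 oner_neq0.
have [i ei] : exists i, e 0 i != 0.
  apply: contrapT => /forallNP ei; move/eqP: e0; apply; apply/rowP => j.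
  by rewrite mxE; apply/eqP; rewrite -[_ == _]negbK; apply/negP/ei.
(* Scaling by a positive factor keeps the direction [e], and [delta / 2] gives a norm below
   [delta]. *)
pose a := (delta / 2) *: e.
have a0 : a != 0 by rewrite scaler_eq0 negb_or e0 gt_eqF ?divr_gt0.
have ai : 0 < `|a 0 i| by rewrite normr_gt0 mxE mulf_neq0// gt_eqF ?divr_gt0.
have na : enorm a < delta.
  by rewrite enormZ e1 mulr1 gtr0_norm ?divr_gt0// ltr_pdivrMr// ltr_pMr//
    ltr1n.
have nearU : \forall h \near a, U (direction h).
  apply: (direction_continuous a0).
  by rewrite direction_scale ?divr_gt0//; exact: open_nbhs_nbhs.
have neard : \forall h \near a, enorm h < delta.
  exact: (@cvgr_lt _ _ _ _ (@enorm R n) _ (@enorm_continuous R n a) _ na).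
have neari : nbhs a (fun h : 'rV[R]_n => `|a 0 i| / 2 < `|h 0 i|).
  have := (@cvgr_gt _ _ (nbhs a) _ (fun h : 'rV[R]_n => `|h 0 i|) `|a 0 i|).
  apply; last by rewrite ltr_pdivrMr// ltr_pMr// ltr1n.
  by apply: cvg_norm; exact: coord_continuous.
have : nbhs a (fun h : 'rV[R]_n => [/\ U (direction h),
    enorm h < delta & `|a 0 i| / 2 < `|h 0 i|]).
  by near=> h; split; near: h.
(* Balls of the library norm are those of the sup norm, hence coordinate boxes. *)
move=> /nbhs_ballP[r /= r0 ar]; exists a, r, (`|a 0 i| / 2), i; split => //.
  by rewrite divr_gt0.
move=> h ha; have [|Uh hd hi] := ar h.
  by split => // j k; rewrite !ord1 /ball/= distrC.
split => //; rewrite IE; have h0 : h != 0.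
  apply: contraTneq hi => ->; rewrite [(0 : 'rV_n) 0 i]mxE normr0 -leNgt.
  by rewrite divr_ge0.
by split => //; left; split => //; exact: enorm_direction.
Unshelve. all: by end_near. Qed.

(** * Volume of boxes and of slabs inside them *)

Definition rV_box (R : realType) n (a : 'rV[R]_n) (r : R) : set 'rV[R]_n :=
  [set h | forall j, `|h 0 j - a 0 j| < r].

Lemma sume_constE (R : realDomainType) m (c : \bar R) :
  (\sum_(j < m) c = m%:R%:E * c)%E.
Proof.
rewrite mule_natl; elim: m => [|m IHm]; first by rewrite big_ord0.
by rewrite big_ord_recl IHm muleS.
Qed.

Section rV_box.
Context {R : realType} {n : nat}.
Implicit Types (a v : 'rV[R]_n) (r : R).

Lemma rV_boxE a r : rV_box a r =
  [set h | forall j, `]a 0 j - r, a 0 j + r[%classic (h 0 j)].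
Proof.
by apply/seteqP; split => h /= ha j; move: (ha j);
  rewrite /= in_itv/= ltr_distl.
Qed.

Lemma measurable_rV_box a r : measurable (rV_box a r).
Proof.
rewrite rV_boxE [X in measurable X](_ : _ =
    \bigcap_j (rV_coord j @^-1` `]a 0 j - r, a 0 j + r[%classic)); last first.
  by apply/seteqP; split => v /= Bv i; [move=> _|]; exact: Bv.
apply: fin_bigcap_measurable; first exact: finite_finset.
by move=> i _; rewrite -[X in measurable X]setTI; exact: measurable_rV_coord.
Qed.

Lemma lebesgue_rV_rV_box a r : 0 < r ->
  lebesgue_rV (rV_box a r) = ((2 * r) ^+ n)%:E.
Proof.
move=> r0; rewrite rV_boxE.
rewrite (lebesgue_rV_box (A := fun j => `]a 0 j - r, a 0 j + r[%classic))//.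
rewrite (eq_bigr (fun=> (2 * r)%:E)) => [|i _].
  by rewrite prodEFin prodr_const card_ord.
rewrite lebesgue_measure_itv/= lte_fin ltrD2l gtrN// -EFinB; congr EFin.
by ring.
Qed.

(* The translates of the slab [S] by [3 eta j] along the [i]-th axis, [j <= K],
   are disjoint and stay in a larger box. *)
Lemma lebesgue_rV_slab_le a r v (i : 'I_n) (S : set 'rV[R]_n) (K : nat)
    (eta : R) :
  0 < eta -> 3 * eta * K%:R <= 1 -> v 0 i != 0 -> measurable S ->
  S `<=` rV_box a r `&` [set h | `|dotv v h| <= eta * `|v 0 i|] ->
  (K.+1%:R%:E * lebesgue_rV S <= lebesgue_rV (rV_box a (r + 1)))%E.
Proof.
move=> eta0 etaK vi0 mS Sv.
pose w (j : nat) : 'rV[R]_n := (3 * eta * j%:R) *: delta_mx 0 i.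
pose F (j : 'I_K.+1) := +%R (w j) @^-1` S.
have mF j : measurable (F j).
  by rewrite -[X in measurable X]setTI; apply: measurable_addv.
(* Between distinct indices the shift changes [dotv v] by at least [3 * eta * |v 0 i|], whereas on
   [S] this form varies by at most [2 * eta * |v 0 i|]; hence the disjointness. *)
have vw j h : dotv v (w j + h) = 3 * eta * j%:R * v 0 i + dotv v h.
  rewrite dotvDr dotvZr; congr (_ * _ + _).
  rewrite /dotv (bigD1 i)//= big1 => [|k ki]; rewrite mxE eqxx/=.
    by rewrite eqxx mulr1 addr0.
  by rewrite (negbTE ki) mulr0.
have tF : trivIset setT F.
  apply/trivIsetP => j k _ _ jk; apply/seteqP; split => // h.
  move=> [/Sv[_ /= hj] /Sv[_ /= hk]].
  wlog jltk : j k jk hj hk / (j < k)%N.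
    move=> wl; have := jk; rewrite -(inj_eq val_inj) neq_ltn => /orP[|] ?.
      exact: (wl j k).
    by apply: (wl k j) => //; rewrite eq_sym.
  have : 3 * eta * (k%:R - j%:R) * `|v 0 i| <= 2 * (eta * `|v 0 i|).
    have kj : 0 <= k%:R - j%:R :> R by rewrite subr_ge0 ler_nat ltnW.
    rewrite -[X in X * `|v 0 i|]ger0_norm ?mulr_ge0 ?(ltW eta0)// -normrM.
    have -> : 3 * eta * (k%:R - j%:R) * v 0 i =
        dotv v (w k + h) - dotv v (w j + h) by rewrite !vw; ring.
    by apply: le_trans (ler_normB _ _) _; lra.
  rewrite mulrA ler_pM2r ?normr_gt0//; apply/negP; rewrite -ltNge.
  rewrite -mulrA [ltLHS]mulrC [ltRHS]mulrC -!mulrA ltr_pM2l//.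
  have : 1 <= k%:R - j%:R :> R by rewrite lerBrDr nat1r ler_nat.
  by lra.
rewrite -sume_constE.
rewrite (eq_bigr (fun j => lebesgue_rV (F j))); last first.
  by move=> j _; rewrite lebesgue_rV_shift.
rewrite -(measure_bigsetU_ord _ xpredT mF tF).
apply: le_measure; rewrite ?inE.
- exact: bigsetU_measurable.
- exact: measurable_rV_box.
rewrite -bigcup_mkord_ord => h [k _]; set j : 'I_K.+1 := inord k.
move=> /Sv[/= hj _] l.
(* The bound on [3 * eta * K] keeps all shifts within 1, which is the margin added to [r]. *)
have wl : `|w j 0 l| <= 1.
  rewrite /w !mxE eqxx/=; case: eqP => _; last by rewrite mulr0 normr0.
  rewrite mulr1 ger0_norm ?mulr_ge0 ?(ltW eta0)//.
  apply: le_trans etaK; rewrite ler_pM2l ?mulr_gt0// ler_nat.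
  by have := ltn_ord j; rewrite ltnS.
have := hj l; rewrite mxE => hl.
rewrite (_ : h 0 l - a 0 l = (w j 0 l + h 0 l - a 0 l) - w j 0 l); last by ring.
by apply: le_lt_trans (ler_normB _ _) _; lra.
Qed.

End rV_box.

(** * Coercivity of the averaged quadratic form *)

(** Let [i] be the coordinate where [|v|] is largest. A thin slab [|v . h| <= eta |v_i|], with [eta]
    independent of [v], takes up at most half of the measure of [B]. On the rest the integrand is at
    least [eta^2 v_i^2], which dominates a multiple of [|v|^2]. *)
Lemma integral_sqr_dotv_ge (R : realType) n (a : 'rV[R]_n) (r : R)
    (B : set 'rV[R]_n) :
  0 < r -> measurable B -> B `<=` rV_box a r -> (0 < lebesgue_rV B)%E ->
  exists2 c : R, 0 < c & forall v,
    ((c * enorm v ^+ 2)%:E <= \int[lebesgue_rV]_(h in B) (dotv v h ^+ 2)%:E)%E.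
Proof.
move=> r0 mB Ba B0.
have mu_box t : 0 < t -> (lebesgue_rV (rV_box a t) < +oo)%E.
  by move=> t0; rewrite lebesgue_rV_rV_box// ltry.
have fin_le S : measurable S -> S `<=` B -> lebesgue_rV S \is a fin_num.
  move=> mS SB; rewrite ge0_fin_numE; last exact: measure_ge0.
  apply: le_lt_trans (mu_box _ r0); apply: le_measure; rewrite ?inE//.
    exact: measurable_rV_box.
  exact: subset_trans Ba.
have := B0; rewrite -(fineK (fin_le _ mB _))//; set b := fine _.
rewrite lte_fin => b0.
pose m := (2 * (r + 1)) ^+ n.
have m0 : 0 < m by rewrite exprn_gt0// mulr_gt0// addr_gt0.
(* [K.+1] disjoint copies of the slab fit into a box of volume [m], so with this [K] the slab has
   measure at most [b / 2]. *)
have [K mK] : exists K : nat, 2 * m <= b * K.+1%:R.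
  exists (Num.truncn (2 * m / b)).
  by rewrite [leRHS]mulrC -ler_pdivrMr// ltW// truncnS_gt.
pose eta : R := (3 * K.+1%:R)^-1.
have K0 : 0 < K.+1%:R :> R by rewrite ltr0n.
have eta0 : 0 < eta by rewrite invr_gt0 mulr_gt0.
have etaK : 3 * eta * K%:R <= 1.
  rewrite /eta invfM mulrA divff// mul1r mulrC ler_pdivrMr// mul1r ler_nat.
  exact: leqnSn.
(* The divisor [n.+1], instead of [n], keeps the constant positive when [n] is 0. *)
exists (eta ^+ 2 / n.+1%:R * (b / 2)).
  by rewrite mulr_gt0 ?divr_gt0 ?exprn_gt0.
move=> v; have [->|v0] := eqVneq v 0.
  rewrite (_ : enorm 0 = 0); last by apply/eqP; rewrite enorm_eq0.
  rewrite expr0n mulr0; apply: integral_ge0 => h _.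
  by rewrite lee_fin sqr_ge0.
have [i0 _] : exists i, v 0 i != 0.
  apply: contrapT => /forallNP vi; move/eqP: v0; apply; apply/rowP => j.
  by rewrite mxE; apply/eqP; rewrite -[_ == _]negbK; apply/negP/vi.
pose i := [arg max_(i > i0) `|v 0 i|]%O.
have vi j : `|v 0 j| <= `|v 0 i|.
  by rewrite /i; case: arg_maxP => // k _; exact.
have vi0 : v 0 i != 0.
  apply: contraNneq v0 => vi0; apply/eqP/rowP => j; rewrite mxE.
  by apply/eqP; rewrite -normr_le0 (le_trans (vi j))// vi0 normr0.
have mdot : measurable_fun setT (dotv v : 'rV[R]_n -> R).
  by apply: measurable_dotv.
pose S := B `&` [set h | `|dotv v h| <= eta * `|v 0 i|].
have mS : measurable S.
  apply: measurableI => //; rewrite -[X in measurable X]setTI.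
  have := measurableT_comp (@normr_measurable R setT) mdot.
  move=> /(_ measurableT `]-oo, (eta * `|v 0 i|)]%classic (measurable_itv _)).
  by congr measurable; apply/seteqP; split => h /=; rewrite in_itv.
have SB : S `<=` B by move=> ? [].
have mBS : measurable (B `\` S) by exact: measurableD.
have Sb : fine (lebesgue_rV S) <= b / 2.
  have := @lebesgue_rV_slab_le R n a r v i S K eta eta0 etaK vi0 mS.
  rewrite lebesgue_rV_rV_box ?addr_gt0// -(fineK (fin_le _ mS SB)) -EFinM.
  rewrite lee_fin -/m.
  have SS : S `<=` rV_box a r `&` [set h | `|dotv v h| <= eta * `|v 0 i|].
    by move=> h [/Ba].
  move=> /(_ SS) Sm; rewrite ler_pdivlMr// -(ler_pM2r K0); lra.
have BSb : b / 2 <= fine (lebesgue_rV (B `\` S)).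
  have := measureDI lebesgue_rV mB mS; rewrite setIC (setIidl SB).
  move=> /(congr1 fine); rewrite fineD; last 2 first.
  - exact: fin_le.
  - exact: fin_le.
  by rewrite -/b; move: Sb; lra.
have vn : enorm v ^+ 2 <= n.+1%:R * `|v 0 i| ^+ 2.
  rewrite sqr_enorm /dotv; apply: (@le_trans _ _ (\sum_(j < n) `|v 0 i| ^+ 2)).
    apply: ler_sum => j _; rewrite -expr2 -(real_normK (num_real (v 0 j))).
    by rewrite lerXn2r ?nnegrE.
  by rewrite sumr_const card_ord -[leLHS]mulr_natl ler_wpM2r ?sqr_ge0// ler_nat.
apply: (@le_trans _ _
  (\int[lebesgue_rV]_(h in B `\` S) ((eta * `|v 0 i|) ^+ 2)%:E)%E).
  have BSE : lebesgue_rV (B `\` S) = (fine (lebesgue_rV (B `\` S)))%:E.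
    by rewrite fineK// fin_le.
  rewrite integral_cst//= [X in (_ * X)%E]BSE -EFinM lee_fin exprMn.
  rewrite mulrAC; apply: ler_pM => //.
  - by rewrite mulr_ge0 ?sqr_ge0// divr_ge0 ?sqr_ge0.
  - by rewrite divr_ge0 ?ltW.
  rewrite -[X in X <= _]mulrA ler_pM2l ?exprn_gt0// mulrC ler_pdivrMr ?ltr0n//.
  by rewrite mulrC.
have mf : measurable_fun B (fun h => (dotv v h ^+ 2)%:E).
  by apply/measurable_EFinP; apply: measurable_funTS; exact: measurable_funX.
apply: (@le_trans _ _
  (\int[lebesgue_rV]_(h in B `\` S) (dotv v h ^+ 2)%:E)%E); last first.
  apply: ge0_subset_integral => //.
  by move=> h _; rewrite lee_fin sqr_ge0.
apply: ge0_le_integral => //.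
- by move=> h _; rewrite lee_fin sqr_ge0.
- by apply: measurable_funS mf.
- move=> h [Bh Sh]; rewrite lee_fin -[leRHS]real_normK ?num_real//.
  rewrite lerXn2r ?nnegrE// ?mulr_ge0 ?(ltW eta0)//.
  rewrite leNgt; apply/negP => hv; apply: Sh; split => //=; exact: ltW.
Qed.

(** * The estimate in a single direction *)

(** Cauchy-Schwarz against the constant sequence 1; the induction step sums
    [2 a_j a_N <= a_j^2 + a_N^2] over [j < N]. *)
Lemma sqr_sum_le (R : realDomainType) (N : nat) (a : nat -> R) :
  (\sum_(j < N) a j) ^+ 2 <= N%:R * \sum_(j < N) a j ^+ 2.
Proof.
elim: N => [|N IHN]; first by rewrite !big_ord0 mul0r expr0n.
rewrite !big_ord_recr/=.
have : 2 * (\sum_(j < N) a j) * a N <=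
    \sum_(j < N) a j ^+ 2 + N%:R * a N ^+ 2.
  rewrite (_ : N%:R * _ = \sum_(j < N) a N ^+ 2); last first.
    by rewrite sumr_const card_ord mulr_natl.
  rewrite -big_split mulr_sumr mulr_suml.
  apply: ler_sum => j _ /=; rewrite -subr_ge0.
  by rewrite (_ : _ - _ = (a j - a N) ^+ 2) ?sqr_ge0//; ring.
rewrite -natr1; lra.
Qed.

(* Telescoping along [x, x + h, ..., x + N h]. *)
Lemma integral_sqr_le_shift (R : realType) n (f : 'rV[R]_n -> R) (h : 'rV[R]_n)
    (N : nat) :
  measurable_fun setT f -> (forall x, f x != 0 -> f (h *+ N + x) = 0) ->
  (\int[lebesgue_rV]_x (f x ^+ 2)%:E <=
   (N ^ 2)%:R%:E * \int[lebesgue_rV]_x ((f x - f (h + x)) ^+ 2)%:E)%E.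
Proof.
move=> mf f0; pose g x := f x - f (h + x).
have mshift a : measurable_fun setT (fun x : 'rV[R]_n => a + x).
  exact: measurable_addv.
have mg : measurable_fun setT g.
  by apply: measurable_funB => //; exact: measurableT_comp mf (mshift h).
have mg2 a : measurable_fun setT (fun x : 'rV[R]_n => (g (a + x) ^+ 2)%:E).
  apply/measurable_EFinP; apply: measurable_funX.
  exact: measurableT_comp mg (mshift a).
have fg x : f x ^+ 2 <= N%:R * \sum_(j < N) g (h *+ j + x) ^+ 2.
  have [->|fx] := eqVneq (f x) 0.
    by rewrite expr0n mulr_ge0// sumr_ge0// => j _; exact: sqr_ge0.
  apply: le_trans (sqr_sum_le N (fun j => g (h *+ j + x))).
  (* The sum telescopes to [f x - f (h *+ N + x)], whose last term vanishes because [f x] is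
     nonzero. *)
  rewrite (_ : \sum_(j < N) _ = f x)//.
  rewrite -(big_mkord xpredT (fun j => g (h *+ j + x))).
  rewrite (eq_bigr (fun j => - (f (h *+ j.+1 + x) - f (h *+ j + x)))).
    by rewrite sumrN telescope_sumr// f0// sub0r opprK mulr0n add0r.
  by move=> j _; rewrite /g opprB mulrS addrA.
apply: (@le_trans _ _ (\int[lebesgue_rV]_x
    (N%:R%:E * \sum_(j < N) (g (h *+ j + x)%R ^+ 2)%:E))%E).
  apply: ge0_le_integral => //.
  - by move=> x _; rewrite lee_fin sqr_ge0.
  - by apply/measurable_EFinP; exact: measurable_funX.
  - by apply: measurable_funeM; apply: emeasurable_sum => j.
  - by move=> x _; rewrite sumEFin -EFinM lee_fin.
rewrite ge0_integralZl//; last 2 first.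
- by apply: emeasurable_sum => j.
- by move=> x _; apply: sume_ge0 => j _; rewrite lee_fin sqr_ge0.
rewrite ge0_integral_sum//; last by move=> j x _; rewrite lee_fin sqr_ge0.
(* By translation invariance the [N] summands have equal integrals; with the factor [N] from
   Cauchy-Schwarz this makes [N ^ 2]. *)
rewrite (eq_bigr (fun=> \int[lebesgue_rV]_x (g x ^+ 2)%:E)%E); last first.
  move=> j _.
  rewrite (ge0_integral_rV_shift (h *+ j) (f := fun x => (g x ^+ 2)%:E))//.
    by apply/measurable_EFinP; exact: measurable_funX.
  by move=> x; rewrite lee_fin sqr_ge0.
by rewrite sume_constE muleA -EFinM -natrM.
Qed.

(** * Averaging over directions *)

Lemma measurable_energy_density (R : realType) n (u : 'rV[R]_n -> 'rV[R]_n)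
    (B : set 'rV[R]_n) : measurable_fun setT u -> measurable B ->
  measurable_fun setT (fun z : 'rV[R]_n * 'rV[R]_n =>
    (\1_B (z.1 - z.2) * dotv (u z.1 - u z.2) (z.1 - z.2) ^+ 2)%:E).
Proof.
move=> mu_ mB; apply/measurable_EFinP; apply: measurable_funM.
  have m1 : measurable_fun setT (\1_B : 'rV[R]_n -> R).
    exact: measurable_indic.
  by apply: measurableT_comp m1 _; exact: measurable_subv.
apply: measurable_funX; apply: measurable_dotv; apply: measurable_subv => //.
  by apply: measurableT_comp mu_ _; exact: measurable_fst.
by apply: measurableT_comp mu_ _; exact: measurable_snd.
Qed.

(* Substituting [x = y + h] and applying Tonelli turns the double integral into
   an average over [h \in B] of the one-directional estimates above. *)
Lemma integral_sqr_enorm_le_energy (R : realType) n (u : 'rV[R]_n -> 'rV[R]_n)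
    (B : set 'rV[R]_n) (N : nat) (c : R) :
  measurable_fun setT u -> measurable B -> 0 <= c ->
  (forall x h, B h -> u x != 0 -> u (h *+ N + x) = 0) ->
  (forall v, ((c * enorm v ^+ 2)%:E <=
     \int[lebesgue_rV]_(h in B) (dotv v h ^+ 2)%:E)%E) ->
  (c%:E * \int[lebesgue_rV]_x (enorm (u x) ^+ 2)%:E <=
   (N ^ 2)%:R%:E * \int[lebesgue_rV \x lebesgue_rV]_z
     (\1_B (z.1 - z.2)%R * dotv (u z.1 - u z.2)%R (z.1 - z.2)%R ^+ 2)%:E)%E.
Proof.
move=> mu_ mB c0 uN cB.
pose W (z : 'rV[R]_n * 'rV[R]_n) :=
  (\1_B (z.1 - z.2) * dotv (u z.1 - u z.2) (z.1 - z.2) ^+ 2)%:E.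
rewrite -[X in (_ <= _ * X)%E]/(\int[lebesgue_rV \x lebesgue_rV]_z W z)%E.
have m1 : measurable_fun setT (\1_B : 'rV[R]_n -> R) by exact: measurable_indic.
have mW : measurable_fun setT W by exact: measurable_energy_density.
have W0 z : (0 <= W z)%E by rewrite lee_fin mulr_ge0 ?sqr_ge0.
rewrite fubini_tonelli2// /fubini_G.
pose H (z : 'rV[R]_n * 'rV[R]_n) :=
  (\1_B z.2 * (dotv (u z.1) z.2 - dotv (u (z.2 + z.1)) z.2) ^+ 2)%:E.
pose G (z : 'rV[R]_n * 'rV[R]_n) := (\1_B z.2 * dotv (u z.1) z.2 ^+ 2)%:E.
have m12 : measurable_fun setT (fun z : 'rV[R]_n * 'rV[R]_n => \1_B z.2 : R).
  exact: measurableT_comp m1 measurable_snd.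
have mu1 : measurable_fun setT (fun z : 'rV[R]_n * 'rV[R]_n => u z.1).
  exact: measurableT_comp mu_ measurable_fst.
have mu12 : measurable_fun setT (fun z : 'rV[R]_n * 'rV[R]_n => u (z.2 + z.1)).
  by apply: measurableT_comp mu_ _; exact: measurable_addv.
have mH : measurable_fun setT H.
  apply/measurable_EFinP; apply: measurable_funM => //; apply: measurable_funX.
  by apply: measurable_funB; exact: measurable_dotv.
have mG : measurable_fun setT G.
  apply/measurable_EFinP; apply: measurable_funM => //; apply: measurable_funX.
  exact: measurable_dotv.
have H0 z : (0 <= H z)%E by rewrite lee_fin mulr_ge0 ?sqr_ge0.
have G0 z : (0 <= G z)%E by rewrite lee_fin mulr_ge0 ?sqr_ge0.
rewrite [X in (_ <= _ * X)%E](_ : _ =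
    \int[lebesgue_rV]_y \int[lebesgue_rV]_h H (y, h))%E; last first.
  apply: eq_integral => y _.
  transitivity (\int[lebesgue_rV]_h W (y + h, y)%R)%E.
    have mWy : measurable_fun setT (fun x => W (x, y)).
      exact: measurableT_comp mW (measurable_pair2 y).
    exact: (esym (ge0_integral_rV_shift y mWy (fun x => W0 (x, y)))).
  apply: eq_integral => h _; rewrite /W /H /=.
  by rewrite [y + h]addrC addrK dotvBl -sqrrN opprB.
have mHG := measurable_fun_fubini_tonelli_G (m1 := lebesgue_rV) H mH H0.
have mGG := measurable_fun_fubini_tonelli_G (m1 := lebesgue_rV) G mG G0.
have mGF := measurable_fun_fubini_tonelli_F (m2 := lebesgue_rV) G mG G0.
rewrite (fubini_tonelli (m1 := lebesgue_rV) (m2 := lebesgue_rV) H)//.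
have iH0 h : (0 <= \int[lebesgue_rV]_y H (y, h))%E by exact: integral_ge0.
have iG0 h : (0 <= \int[lebesgue_rV]_y G (y, h))%E by exact: integral_ge0.
(* The middle term is the double integral of [(u y . h)^2] over all [y] and over [h] in [B].
   Integrated first in [h] it is bounded below through [cB]; integrated first in [y] it is bounded
   above by telescoping. *)
apply: (@le_trans _ _ (\int[lebesgue_rV]_h \int[lebesgue_rV]_y G (y, h))%E).
  rewrite -(fubini_tonelli (m1 := lebesgue_rV) (m2 := lebesgue_rV) G)//.
  have me : measurable_fun setT (fun x : 'rV[R]_n => (enorm (u x) ^+ 2)%:E).
    apply/measurable_EFinP.
    rewrite (_ : (fun _ => _) = fun x => dotv (u x) (u x)).
      exact: measurable_dotv.
    by apply/funext => x; rewrite sqr_enorm.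
  rewrite -ge0_integralZl//; last by move=> x _; rewrite lee_fin sqr_ge0.
  apply: ge0_le_integral => //.
  - by move=> x _; rewrite mule_ge0 ?lee_fin ?sqr_ge0.
  - exact: measurable_funeM.
  move=> y _; rewrite -EFinM; apply: le_trans (cB (u y)) _.
  rewrite integral_mkcond le_eqVlt; apply/orP; left; apply/eqP.
  apply: eq_integral => h _; rewrite patchE /G /= indicE.
  by case: (h \in B); rewrite ?mul1r ?mul0r.
rewrite -ge0_integralZl//.
apply: ge0_le_integral => //; first exact: measurable_funeM.
move=> h _; have [Bh|Bh] := pselect (B h); last first.
  rewrite integral0_eq; first by rewrite mule_ge0.
  by move=> y _; rewrite /G /= indicE memNset// mul0r.
have mf : measurable_fun setT (fun y => dotv (u y) h) by exact: measurable_dotv.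
have GE y : G (y, h) = (dotv (u y) h ^+ 2)%:E.
  by rewrite /G /= indicE mem_set// mul1r.
have HE y : H (y, h) = ((dotv (u y) h - dotv (u (h + y)) h) ^+ 2)%:E.
  by rewrite /H /= indicE mem_set// mul1r.
under eq_integral do rewrite GE.
under [in leRHS]eq_integral do rewrite HE.
(* For fixed [h] in [B] the scalar function [u . h] vanishes wherever [u] does, so it inherits the
   vanishing after [N] steps. *)
apply: (@integral_sqr_le_shift R n (fun y => dotv (u y) h) h N mf) => x xh.
have dot0 : dotv 0 h = 0 by rewrite /dotv big1// => i _; rewrite mxE mul0r.
by rewrite uN//; apply: contraNneq xh => ->; rewrite dot0.
Qed.

(** * Passage to the [L2] norm and to the energy of [rho] *)

Lemma poweR2 (R : realType) (x : \bar R) : (0 <= x -> x `^ 2 = x ^+ 2)%E.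
Proof.
case: x => [r|_|//]; last first.
  by rewrite poweRE pnatr_eq0 /=; exact/esym/mulyy.
by rewrite lee_fin => r0; rewrite poweR_EFin powR_mulrn// EFin_expe.
Qed.

Lemma sqr_L2norm (R : realType) n (u : 'rV[R]_n -> 'rV[R]_n) :
  (L2norm u ^+ 2 = \int[lebesgue_rV]_x (enorm (u x) ^+ 2)%:E)%E.
Proof.
rewrite -poweR2 ?Lnorm_ge0// poweR_Lnorm ?pnatr_eq0//.
apply: eq_integral => x _; rewrite poweR2//.
by rewrite abse_EFin ger0_norm ?sqrtr_ge0// EFin_expe.
Qed.

(** When [x - y] lies in [B], the weight exceeds [eps], and normalizing [x - y] divides the square
    by [|x - y|^2 < delta^2]. The Borel version of [u] differs from [u] only over pairs with a
    component in [N], a null set for the product measure. The integrand on the right may fail to be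
    Borel, hence the comparison lemma for nonmeasurable functions. *)
Lemma energy_ge_restricted (R : realType) n (rho : 'rV[R]_n -> R)
    (u : 'rV[R]_n -> 'rV[R]_n) (N B : set 'rV[R]_n) (eps delta : R) :
  0 < eps -> 0 < delta -> (forall x, 0 <= rho x) ->
  measurable N -> lebesgue_rV N = 0%E -> measurable B ->
  (forall h, B h -> [/\ eps < rho h, h != 0 & enorm h < delta]) ->
  measurable_fun setT (u \_ (~` N)) ->
  ((eps / delta ^+ 2)%:E * \int[lebesgue_rV \x lebesgue_rV]_z
     (\1_B (z.1 - z.2)%R * dotv ((u \_ (~` N)) z.1 - (u \_ (~` N)) z.2)%R
       (z.1 - z.2)%R ^+ 2)%:E <=
   energy (fun z => (rho (z.1 - z.2))%:E) u)%E.
Proof.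
move=> eps0 delta0 rho0 mN N0 mB Brho mu_.
set v := u \_ (~` N).
have c0 : 0 <= eps / delta ^+ 2 by rewrite divr_ge0 ?sqr_ge0// ltW.
rewrite -ge0_integralZl//; last 2 first.
- exact: measurable_energy_density.
- by move=> z _; rewrite lee_fin mulr_ge0 ?sqr_ge0.
have mX : measurable (N `*` setT `|` setT `*` N : set ('rV[R]_n * 'rV[R]_n)).
  by apply: measurableU; exact: measurableX.
have X1 : (lebesgue_rV \x lebesgue_rV)%E (N `*` [set: 'rV[R]_n]) = 0%E.
  by rewrite product_measure1E// [X in (X * _)%E]N0 mul0e.
have X2 : (lebesgue_rV \x lebesgue_rV)%E ([set: 'rV[R]_n] `*` N) = 0%E.
  by rewrite product_measure1E// [X in (_ * X)%E]N0 mule0.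
apply: (ge0_ae_le_integral_nonmeasurable
  (mu := (lebesgue_rV \x lebesgue_rV)%E) mX).
- apply/(negligibleP _ mX); apply: negligibleU.
  + by apply/negligibleP; [exact: measurableX|exact: X1].
  + by apply/negligibleP; [exact: measurableX|exact: X2].
- by move=> z; rewrite -EFinM lee_fin mulr_ge0// mulr_ge0 ?sqr_ge0.
- by move=> z; rewrite -EFinM lee_fin mulr_ge0 ?sqr_ge0.
move=> [x y] /= /not_orP[Nx Ny].
have -> : v x = u x by rewrite /v patchE mem_set// => ?; apply: Nx.
have -> : v y = u y by rewrite /v patchE mem_set// => ?; apply: Ny.
rewrite -!EFinM lee_fin; have [Bxy|Bxy] := pselect (B (x - y)); last first.
  by rewrite indicE memNset// mul0r mulr0 mulr_ge0 ?sqr_ge0.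
have [rxy xy0 xyd] := Brho _ Bxy.
rewrite indicE mem_set// mul1r /direction dotvZr exprMn [leRHS]mulrA.
apply: ler_pM => //; first exact: sqr_ge0.
apply: ler_pM => //; [exact: ltW|by rewrite invr_ge0 sqr_ge0|exact: ltW|].
rewrite exprVn lef_pV2 ?posrE ?exprn_gt0 ?enorm_gt0//.
by rewrite lerXn2r ?nnegrE ?sqrtr_ge0 ?ltW.
Qed.

(** * The Poincaré inequality, with a constant chosen before the kernel *)

Theorem proposition2p7 (R : realType) (d : nat) (d_gt0 : (0 < d)%N)
    (Omega : set 'rV[R]_d) (Omega_open : open Omega)
    (Omega_bounded : bounded_set Omega)
    (rho : 'rV[R]_d -> R)
    (rho_even : forall x, rho (- x) = rho x)
    (rho_ge0 : forall x, 0 <= rho x)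
    (rho_L1 : L1 (EFin \o rho))
    (delta0 : R) (delta0_gt0 : 0 < delta0)
    (Lambda : set 'rV[R]_d) (Lambda_cone : double_cone Lambda)
    (rho_gt0 : Lambda `&` eball delta0 `<=` [set h | 0 < rho h])
    (c0 : R) (c0_gt0 : 0 < c0) :
  exists2 CP : R, 0 < CP &
    forall k : 'rV[R]_d * 'rV[R]_d -> \bar R,
      completed_measurable_fun (lebesgue_rV \x lebesgue_rV)%E k ->
      (forall z, (0 <= k z)%E) ->
      cond_SM k ->
      (forall u, S_space Omega k u ->
        (energy (ksym k) u >=
         c0%:E * energy (fun z => (rho (z.1 - z.2))%:E) u)%E) ->
      forall u, S_space Omega k u ->
        (L2norm u ^+ 2 <= CP%:E * energy (ksym k) u)%E.
Proof.
have [a [r [s [i [r0 s0 box]]]]] := double_cone_box Lambda_cone delta0_gt0.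
have Q0 : (0 < lebesgue_rV (rV_box a r))%E.
  by rewrite lebesgue_rV_rV_box// lte_fin exprn_gt0// mulr_gt0.
have rhoQ x : rV_box a r x -> 0 < rho x.
  by move=> /box[Lx dx _]; exact: rho_gt0.
have [eps [B [eps0 mB BQ B0 Beps]]] :=
  completed_superlevel_measure_gt0 rho_L1.1 (measurable_rV_box a r) Q0 rhoQ.
have [c c_gt0 cB] := integral_sqr_dotv_ge r0 mB BQ B0.
have [M MO] : exists M : R, forall x, Omega x -> `|x 0 i| <= M.
  (* Boundedness holds for every bound strictly above a threshold [M], hence [M + 1]. *)
  have [M [_ MO]] := Omega_bounded; exists (M + 1) => x Ox.
  apply: le_trans (MO (M + 1) _ _ Ox); last by rewrite ltrDl.
  rewrite [leRHS]/Num.norm /= mx_normrE.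
  by apply/bigmax_geP; right => /=; exists (0, i).
(* After [N] steps the [i]-th coordinate has moved by more than [2 * M], so [x] and [h *+ N + x]
   cannot both lie in [Omega]. *)
have [K KM] : exists K : nat, 2 * M < K.+1%:R * s.
  by exists (Num.truncn (2 * M / s)); rewrite -ltr_pdivrMr// truncnS_gt.
set N := K.+1 in KM.
have N0 : 0 < (N ^ 2)%:R :> R by rewrite ltr0n expn_gt0.
have ed0 : 0 < eps / delta0 ^+ 2 by rewrite divr_gt0// exprn_gt0.
(* The factors come from coercivity over [B], telescoping, the lower bound for [rho] on [B], and
   (ii). All are fixed before [k] is introduced. *)
exists (c^-1 * (N ^ 2)%:R * (eps / delta0 ^+ 2)^-1 * c0^-1).
  by rewrite !mulr_gt0 ?invr_gt0.
move=> k _ _ _ k_rho u uS; have [mu_ _ u0 _] := uS.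
(* The null set [Z] also contains the points outside [Omega] where [u] is nonzero, so [v] is a Borel
   version of [u] that vanishes everywhere off [Omega]. *)
have [Z [mZ Z0 uZ mv]] := completed_measurable_funE mu_ u0.
set v := u \_ (~` Z) in mv.
have vO x : v x != 0 -> Omega x.
  rewrite /v patchE; case: ifPn => [/set_mem Zx ux|_]; last first.
    (* On [Z] the restriction takes the default value [point], which is the zero vector. *)
    by rewrite (_ : point = 0) ?eqxx//; apply/rowP => j; rewrite !mxE.
  apply: contrapT => Ox; apply: Zx; apply: uZ => /= /(_ Ox) ux0.
  by rewrite ux0 eqxx in ux.
have vN x h : B h -> v x != 0 -> v (h *+ N + x) = 0.
  move=> /BQ/box[_ _ sh] vx; apply/eqP; apply: contraPT isT => vNx.
  have := MO _ (vO _ vx); have := MO _ (vO _ vNx).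
  rewrite mxE mulmxnE => hM xM.
  have : `|h 0 i *+ N| <= 2 * M.
    rewrite -[h 0 i *+ N](addrK (x 0 i)).
    by apply: le_trans (ler_normB _ _) _; lra.
  rewrite normrMn -mulr_natl => hN; have := ltW sh.
  by rewrite -(ler_pM2l (x := N%:R)) ?ltr0n//; lra.
have I1 := integral_sqr_enorm_le_energy mv mB (ltW c_gt0) vN cB.
have Bh h : B h -> [/\ eps < rho h, h != 0 & enorm h < delta0].
  move=> Bh; have [_ hd sh] := box h (BQ _ Bh); split=> //; first exact: Beps.
  by apply: contraTneq sh => ->; rewrite mxE normr0 -leNgt ltW.
have I2 := energy_ge_restricted eps0 delta0_gt0 rho_ge0 mZ Z0 mB Bh mv.
have I3 := k_rho u uS.
have I0 : (L2norm u ^+ 2 <= \int[lebesgue_rV]_x (enorm (v x) ^+ 2)%:E)%E.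
  rewrite sqr_L2norm; apply: (ge0_ae_le_integral_nonmeasurable mZ Z0).
  - by move=> x; rewrite lee_fin sqr_ge0.
  - by move=> x; rewrite lee_fin sqr_ge0.
  - by move=> x Zx; rewrite /v patchE mem_set.
(* The four estimates are chained, each positive constant being moved to the side of the larger
   quantity. *)
apply: le_trans I0 _.
move: I1; rewrite -lee_pdivlMl// => /le_trans; apply.
move: I2; rewrite -lee_pdivlMl// => I2.
move: I3; rewrite -lee_pdivlMl// => I3.
rewrite !EFinM -!muleA.
apply: lee_wpmul2l; first by rewrite lee_fin invr_ge0 ltW.
apply: lee_wpmul2l; first by rewrite lee_fin ltW.
apply: le_trans I2 _; rewrite ?EFinM.
by apply: lee_wpmul2l => //; rewrite lee_fin invr_ge0 ltW.
Qed.
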